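(* Let $(\mathfrak g,[\cdot,\cdots,\cdot]_{\mathfrak g})$ be an $m$-dimensional real $n$-Lie algebra such that it induces a linear Nambu-Poisson structure $\pi_{\mathfrak g}$ on $\mathfrak g^*$. Then the nonabelian omni $n$-Lie algebra $(\mathfrak{gl}(\mathfrak g)\oplus\wedge^{n-1}\mathfrak g,(\cdot,\cdot)_+,\{\cdot,\cdot\}_{\mathfrak g})$ is induced from the higher analogue of the Courant algebroid $(T\mathfrak g^*\oplus\wedge^{n-1}T^*\mathfrak g^*,(\cdot,\cdot)_+,[\![\cdot,\cdot]\!]_{\pi_{\mathfrak g}},\rho_{\pi_{\mathfrak g}})$ associated to the Nambu-Poisson manifold $(\mathfrak g^*,\pi_{\mathfrak g})$ via restriction to $\mathfrak X_{\mathrm{lin}}(\mathfrak g^* )\oplus\Omega^{n-1}_{\mathrm{con}}(\mathfrak g^* )$. More precisely, for all $A,B\in\mathfrak{gl}(\mathfrak g)$, $\mathfrak u,\mathfrak v\in\wedge^{n-1}\mathfrak g$ and $\mathfrak w\in\mathfrak g\otimes\wedge^{n-2}\mathfrak g$, one has $$(\Phi(A+\mathfrak u),\Phi(B+\mathfrak v))_+=\overline{(A+\mathfrak u,B+\mathfrak v)_+},$$ $$[\![\Phi(A+\mathfrak u),\Phi(B+\mathfrak v)]\!]_{\pi_{\mathfrak g}}=\Phi(\{A+\mathfrak u,B+\mathfrak v\}_{\mathfrak g}),$$ $$L_{\rho_{\pi_{\mathfrak g}}\Phi(A+\mathfrak u)}\overline{\mathfrak w}=\overline{\rho_{\mathfrak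 g}(A+\mathfrak u)(\mathfrak w)}.$$
   Context: Let $n\ge2$ be an integer. Algebraic side. An $n$-Lie algebra is a vector space $\mathfrak g$ with an $n$-multilinear skew-symmetric bracket $[\cdot,\cdots,\cdot]_{\mathfrak g}$ such that $[u_1,\dots,u_{n-1},[v_1,\dots,v_n]_{\mathfrak g}]_{\mathfrak g}=\sum_{i=1}^n[v_1,\dots,[u_1,\dots,u_{n-1},v_i]_{\mathfrak g},\dots,v_n]_{\mathfrak g}$ for all $u_i,v_i\in\mathfrak g$. Let $\mathrm{ad}:\wedge^{n-1}\mathfrak g\to\mathfrak{gl}(\mathfrak g)$, $\mathrm{ad}_{u_1\wedge\cdots\wedge u_{n-1}}v=[u_1,\dots,u_{n-1},v]_{\mathfrak g}$. For $A\in\mathfrak{gl}(\mathfrak g)$, $\mathcal L_A$ acts on $\otimes^{n-1}\mathfrak g$ by $\mathcal L_A(v_1\otimes\cdots\otimes v_{n-1})=\sum_{i=1}^{n-1}v_1\otimes\cdots\otimes Av_i\otimes\cdots\otimes v_{n-1}$, and the same symbol denotes the induced maps on $\wedge^{n-1}\mathfrak g$ and $\mathfrak g\otimes\wedge^{n-2}\mathfrak g$. For $\mathfrak u,\mathfrak v\in\wedge^{n-1}\mathfrak g$ put $\mathfrak u\circ\mathfrak v=\mathcal L_{\mathrm{ad}_{\mathfrak u}}\mathfrak v$. The nonabelian omni $n$-Lie algebra of $\mathfrak g$ is $\mathfrak{gl}(\mathfrak g)\oplus\wedge^{n-1}\mathfrak g$ with the bracket $$\{A+\mathfrak u,B+\mathfrak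 v\}_{\mathfrak g}=[A,B]+[A,\mathrm{ad}_{\mathfrak v}]+[\mathrm{ad}_{\mathfrak u},B]-\mathrm{ad}_{\mathcal L_A\mathfrak v}+\mathcal L_A\mathfrak v+\mathfrak u\circ\mathfrak v$$ ($[\cdot,\cdot]$ being the commutator on $\mathfrak{gl}(\mathfrak g)$) and the $(\mathfrak g\otimes\wedge^{n-2}\mathfrak g)$-valued pairing determined by $$(A+\mathfrak u,B+\mathfrak v)_+=\sum_{i=1}^{n-1}(-1)^{i+1}\big(Av_i\otimes v_1\wedge\cdots\wedge\hat v_i\wedge\cdots\wedge v_{n-1}+Bu_i\otimes u_1\wedge\cdots\wedge\hat u_i\wedge\cdots\wedge u_{n-1}\big)$$ for $\mathfrak u=u_1\wedge\cdots\wedge u_{n-1}$, $\mathfrak v=v_1\wedge\cdots\wedge v_{n-1}$. Also $\rho_{\mathfrak g}:\mathfrak{gl}(\mathfrak g)\oplus\wedge^{n-1}\mathfrak g\to\mathfrak{gl}(\mathfrak g\otimes\wedge^{n-2}\mathfrak g)$ is $\rho_{\mathfrak g}(A+\mathfrak u)(\mathfrak w)=\mathcal L_{A+\mathrm{ad}_{\mathfrak u}}\mathfrak w$. Geometric side. A Nambu-Poisson structure of order $n-1$ on a smooth manifold $M$ is (given by) an $n$-vector field $\pi\in\mathfrak X^n(M)$ such that $\{f_1,\dots,f_n\}=\pi(df_1,\dots,df_n)$ satisfies $\{f_1,\dots,f_{n-1},\{g_1,\dots,g_n\}\}=\sum_{i=1}^n\{g_1,\dots,\{f_1,\dots,f_{n-1},g_i\},\dots,g_n\}$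 for all smooth functions. Define $\pi^\sharp:\wedge^{n-1}T^*M\to TM$ by $\langle\pi^\sharp(\xi_1\wedge\cdots\wedge\xi_{n-1}),\xi_n\rangle=\pi(\xi_1\wedge\cdots\wedge\xi_{n-1}\wedge\xi_n)$ for $1$-forms $\xi_i$, and on $\Omega^{n-1}(M)$ the bracket $[\alpha,\beta]_\pi=L_{\pi^\sharp(\alpha)}\beta-L_{\pi^\sharp(\beta)}\alpha+d\,i_{\pi^\sharp(\beta)}\alpha$. The higher analogue of the Courant algebroid associated to $(M,\pi)$ is the bundle $TM\oplus\wedge^{n-1}T^*M$ with pairing $(X+\alpha,Y+\beta)_+=i_X\beta+i_Y\alpha$, bracket $$[\![X+\alpha,Y+\beta]\!]_\pi=[X,Y]+[X,\pi^\sharp(\beta)]+[\pi^\sharp(\alpha),Y]-\pi^\sharp(L_X\beta)+\pi^\sharp(i_Yd\alpha)+L_X\beta-i_Yd\alpha+[\alpha,\beta]_\pi$$ for $X,Y\in\mathfrak X(M)$, $\alpha,\beta\in\Omega^{n-1}(M)$, and bundle map $\rho_\pi(X+\alpha)=X+\pi^\sharp(\alpha)$. Linearization. For $x\in\mathfrak g$ let $l_x$ be the corresponding linear function on $\mathfrak g^*$; for a basis $\{x^i\}$ of $\mathfrak g$, $\{l_{x^i}\}$ are coordinates on $\mathfrak g^*$. Put $$\pi_{\mathfrak g}=\sum_{1\le i_1<\cdots<i_n\le m}l_{[x^{i_1},\dots,x^{i_n}]_{\mathfrak g}}\frac{\partial}{\partial l_{x^{i_1}}}\wedge\cdots\wedge\frac{\partial}{\partial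 l_{x^{i_n}}},$$ so that $\pi_{\mathfrak g}(dl_{y_1},\dots,dl_{y_n})=l_{[y_1,\dots,y_n]_{\mathfrak g}}$; ''$\mathfrak g$ induces a linear Nambu-Poisson structure on $\mathfrak g^*$'' means that $\pi_{\mathfrak g}$ is a Nambu-Poisson structure (this is not automatic). For $A\in\mathfrak{gl}(\mathfrak g)$ let $\widehat A=\sum_i l_{A(x^i)}\frac{\partial}{\partial l_{x^i}}$, a linear vector field. For $\mathfrak u=\sum_{i_1<\cdots<i_{n-1}}\xi_{i_1\cdots i_{n-1}}x^{i_1}\wedge\cdots\wedge x^{i_{n-1}}$ let $\widehat{\mathfrak u}=\sum\xi_{i_1\cdots i_{n-1}}dl_{x^{i_1}}\wedge\cdots\wedge dl_{x^{i_{n-1}}}$, a constant $(n-1)$-form; the same convention is used for $\wedge^{n-2}\mathfrak g$. $\mathfrak X_{\mathrm{lin}}(\mathfrak g^* )$ and $\Omega^{n-1}_{\mathrm{con}}(\mathfrak g^* )$ are the spaces of linear vector fields and constant $(n-1)$-forms on $\mathfrak g^*$, and $\Phi:\mathfrak{gl}(\mathfrak g)\oplus\wedge^{n-1}\mathfrak g\to\mathfrak X_{\mathrm{lin}}(\mathfrak g^* )\oplus\Omega^{n-1}_{\mathrm{con}}(\mathfrak g^* )$, $\Phi(A+\mathfrak u)=\widehat A+\widehat{\mathfrak u}$, is a linear isomorphism. For $v\otimes\mathfrak u\in\mathfrak g\otimes\wedge^{n-2}\mathfrak g$ let $\overline{v\otimes\mathfrak u}=l_v\widehat{\mathfrak u}$,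 extended linearly to $\mathfrak g\otimes\wedge^{n-2}\mathfrak g$. *)

(* Defs.v *)
From HB Require Import structures.
From mathcomp Require Import all_boot all_order all_algebra all_fingroup.
From mathcomp Require Import all_classical all_reals all_analysis.

Set Implicit Arguments.
Unset Strict Implicit.
Unset Printing Implicit Defensive.

Import Order.TTheory GRing.Theory Num.Theory numFieldNormedType.Exports.
Local Open Scope ring_scope.

(* The arity n >= 2 is written N.+2 throughout, so that n - 1 = N.+1 and
   n - 2 = N are usable as exponents of exterior powers. *)

Section Families.
Variable T : Type.
Implicit Types (k : nat) (w : T).

Definition fcons k w (v : 'I_k -> T) : 'I_k.+1 -> T :=
  fun i => oapp v w (unlift ord0 i).

Definition fsnoc k (v : 'I_k -> T) w : 'I_k.+1 -> T :=
  fun i => oapp v w (unlift ord_max i).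

Definition upd k (v : 'I_k -> T) (i : 'I_k) w : 'I_k -> T :=
  fun j => if j == i then w else v j.

Definition omit k (v : 'I_k.+1 -> T) (i : 'I_k.+1) : 'I_k -> T :=
  fun j => v (lift i j).
End Families.

Section Multilinear.
Variables (K : comNzRingType) (V W : lmodType K) (k : nat).

Definition multilinear (f : ('I_k -> V) -> W) : Prop :=
  forall v i (a : K) w w',
    f (upd v i (a *: w + w')) = a *: f (upd v i w) + f (upd v i w').

Definition skew_symmetric (f : ('I_k -> V) -> W) : Prop :=
  forall (s : 'S_k) v, f (fun i => v (s i)) = (-1) ^+ s *: f v.

Definition alt_multilinear (f : ('I_k -> V) -> W) : Prop :=
  multilinear f /\ skew_symmetric f.
End Multilinear.

Section NLie.
Variables (K : fieldType) (g : vectType K) (N : nat).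

Record nLie_bracket (br : ('I_N.+2 -> g) -> g) : Prop := NLieBracket {
  nLie_multilinear : multilinear br;
  nLie_skew : skew_symmetric br;
  nLie_fundamental : forall (u : 'I_N.+1 -> g) (v : 'I_N.+2 -> g),
    br (fsnoc u (br v)) = \sum_(i < N.+2) br (upd v i (br (fsnoc u (v i))))
}.
End NLie.

(* Strictly increasing multi-indices 0 <= i_1 < ... < i_k < m. *)
Definition increasing m k (I : {ffun 'I_k -> 'I_m}) : bool :=
  [forall a : 'I_k, forall b : 'I_k, (a < b)%N ==> (I a < I b)%N].

Definition mindex m k := {I : {ffun 'I_k -> 'I_m} | increasing I}.

(* Exterior powers of a vector space g with basis x_1, ..., x_m.  The element
   sum_(I increasing) u_I x_(i_1) /\ ... /\ x_(i_k) of /\^k g is the family of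
   its coordinates u_I, and sum_I w_I (x) x_(i_1) /\ ... /\ x_(i_k) in
   g (x) /\^k g is the family of the vectors w_I.  The vector space structures
   are the pointwise ones. *)
Definition ext (K : fieldType) m k := {ffun mindex m k -> K^o}.
Definition text (K : fieldType) (g : vectType K) m k := {ffun mindex m k -> g}.
Arguments ext : clear implicits.
Arguments text {K} g m k.

Section Exterior.
Variables (K : fieldType) (g : vectType K) (m : nat) (x : m.-tuple g).

Definition xfam k (I : mindex m k) : 'I_k -> g := fun a => tnth x (val I a).

Definition wedge k (v : 'I_k -> g) : ext K m k :=
  [ffun I : mindex m k => (\det (\matrix_(a, b) coord x (val I a) (v b)) : K^o)].

(* The linear map /\^k g -> W induced by an alternating k-linear map f;
   see [ext_lift_wedge]. *)
Definition ext_lift k (W : lmodType K) (f : ('I_k -> g) -> W) (u : ext K m k) : W :=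
  \sum_(I : mindex m k) u I *: f (xfam I).

Definition tens k (w : g) (u : ext K m k) : text g m k := [ffun I => u I *: w].

(* The linear map g (x) /\^k g -> W induced by a bilinear map h. *)
Definition text_lift k (W : lmodType K) (h : g -> ext K m k -> W)
    (w : text g m k) : W :=
  \sum_(I : mindex m k) h (w I) (wedge (xfam I)).

Definition Lext k (A : 'End(g)) : ext K m k -> ext K m k :=
  ext_lift (fun v => \sum_(i < k) wedge (upd v i (A (v i)))).

Definition Ltext k (A : 'End(g)) : text g m k -> text g m k :=
  text_lift (fun w u => tens (A w) u + tens w (Lext A u)).
End Exterior.

Section Omni.
Variables (K : fieldType) (g : vectType K) (m N : nat) (x : m.-tuple g).
Variable br : ('I_N.+2 -> g) -> g.

Definition ad (u : ext K m N.+1) : 'End(g) :=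
  linfun (fun w => ext_lift x (fun v => br (fsnoc v w)) u).

Definition ext_circ (u v : ext K m N.+1) : ext K m N.+1 := Lext x (ad u) v.

Definition comm (A B : 'End(g)) : 'End(g) := (A \o B)%VF - (B \o A)%VF.

Definition omni := ('End(g) * ext K m N.+1)%type.

Definition omni_bracket (e f : omni) : omni :=
  let: (A, u) := e in
  let: (B, v) := f in
  (comm A B + comm A (ad v) + comm (ad u) B - ad (Lext x A v),
   Lext x A v + ext_circ u v).

(* The sign (-1) ^+ i is (-1)^(i+1) in 1-based numbering. *)
Definition contraction (A : 'End(g)) : ext K m N.+1 -> text g m N :=
  ext_lift x (fun v =>
    \sum_(i < N.+1) (-1) ^+ i *: tens (A (v i)) (wedge x (omit v i))).

Definition omni_pairing (e f : omni) : text g m N :=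
  let: (A, u) := e in
  let: (B, v) := f in
  contraction A v + contraction B u.

Definition omni_rho (e : omni) : text g m N -> text g m N :=
  Ltext x (e.1 + ad e.2).
End Omni.

(* Differential calculus on the manifold R^m, whose (co)tangent spaces are all
   identified with R^m by means of the coordinate frames.  The operations below
   are total; on smooth tensor fields they are the usual ones. *)
Section Calculus.
Variables (R : realType) (m : nat).
Notation M := 'rV[R]_m.

Definition frame (i : 'I_m) : M := delta_mx 0 i.

Definition dotp (xi v : M) : R := \sum_(i < m) xi 0 i * v 0 i.

Fixpoint Cr (r : nat) (f : M -> R) : Prop :=
  if r is r'.+1 then
    forall i, (forall p, derivable f p (frame i)) /\
              Cr r' (fun p => 'D_(frame i) f p)
  else continuous f.

Definition smooth (f : M -> R) : Prop := forall r, Cr r f.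

Definition vfield := M -> M.
Definition form k := M -> ('I_k -> M) -> R^o.
Definition mvfield k := M -> ('I_k -> M) -> R^o.

Definition is_mvfield k (pi : mvfield k) : Prop :=
  (forall p, alt_multilinear (pi p)) /\ (forall xi, smooth (fun p => pi p xi)).

(* (xi_1 /\ ... /\ xi_k)(v_1, ..., v_k), for covectors xi_a and vectors v_b, or
   for vectors xi_a and covectors v_b. *)
Definition dwedge k (xi v : 'I_k -> M) : R^o :=
  \det (\matrix_(a, b) dotp (xi a) (v b)).

Definition df (f : M -> R) (p : M) : M := \row_i 'D_(frame i) f p.

Definition lie (X Y : vfield) : vfield :=
  fun p => 'D_(X p) Y p - 'D_(Y p) X p.

Definition interior k (X : vfield) (al : form k.+1) : form k :=
  fun p v => al p (fcons (X p) v).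

(* The invariant formula for d on constant vector fields v_0, ..., v_k. *)
Definition ext_d k (al : form k) : form k.+1 :=
  fun p v => \sum_(i < k.+1) (-1) ^+ i * 'D_(v i) (fun q => al q (omit v i)) p.

(* X (al (v_1, ..., v_k)) - sum_i al (v_1, ..., [X, v_i], ..., v_k) on constant
   vector fields v_1, ..., v_k. *)
Definition Lie_form k (X : vfield) (al : form k) : form k :=
  fun p v => 'D_(X p) (fun q => al q v) p
             - \sum_(i < k) al p (upd v i (lie X (fun=> v i) p)).

Definition nambu_bracket k (pi : mvfield k) (f : 'I_k -> M -> R) : M -> R :=
  fun p => pi p (fun i => df (f i) p).

Record nambu_poisson N (pi : mvfield N.+2) : Prop := NambuPoisson {
  np_mvfield : is_mvfield pi;
  np_fundamental : forall (f : 'I_N.+1 -> M -> R) (h : 'I_N.+2 -> M -> R),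
    (forall i, smooth (f i)) -> (forall i, smooth (h i)) ->
    nambu_bracket pi (fsnoc f (nambu_bracket pi h))
    = \sum_(i < N.+2)
        nambu_bracket pi (upd h i (nambu_bracket pi (fsnoc f (h i))))
}.

Section Courant.
Variables (N : nat) (pi : mvfield N.+2).

Definition frame_fam k (I : mindex m k) : 'I_k -> M := fun a => frame (val I a).

(* An (n-1)-covector is al = sum_I al(e_I) dx_I, so linearity of pi^# and
   <pi^#(xi_1 /\ ... /\ xi_(n-1)), xi_n> = pi (xi_1, ..., xi_n) give the j-th
   component of pi^# al. *)
Definition sharp (al : form N.+1) : vfield :=
  fun p => \row_j \sum_(I : mindex m N.+1)
    al p (frame_fam I) * pi p (fsnoc (frame_fam I) (frame j)).

Definition form_bracket (al be : form N.+1) : form N.+1 :=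
  Lie_form (sharp al) be - Lie_form (sharp be) al
  + ext_d (interior (sharp be) al).

Definition courant := (vfield * form N.+1)%type.

Definition courant_pairing (s t : courant) : form N :=
  let: (X, al) := s in
  let: (Y, be) := t in
  interior X be + interior Y al.

Definition courant_bracket (s t : courant) : courant :=
  let: (X, al) := s in
  let: (Y, be) := t in
  (lie X Y + lie X (sharp be) + lie (sharp al) Y
     - sharp (Lie_form X be) + sharp (interior Y (ext_d al)),
   Lie_form X be - interior Y (ext_d al) + form_bracket al be).

Definition courant_rho (s : courant) : vfield := s.1 + sharp s.2.
End Courant.
End Calculus.

(* The manifold g^* is R^m via the global coordinates l_(x_1), ..., l_(x_m):
   the row p is the functional on g that sends x_i to p_i. *)
Section Linearization.
Variables (R : realType) (g : vectType R) (m : nat) (x : m.-tuple g).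
Notation M := 'rV[R]_m.

Definition lfct (v : g) : M -> R := fun p => \sum_(i < m) coord x i v * p 0 i.

Definition lin_pi N (br : ('I_N.+2 -> g) -> g) : mvfield R m N.+2 :=
  fun p xi => \sum_(I : mindex m N.+2)
    lfct (br (xfam x I)) p * dwedge (frame_fam R I) xi.

Definition hat_end (A : 'End(g)) : vfield R m :=
  fun p => \sum_(i < m) lfct (A (tnth x i)) p *: frame R i.

Definition dl_fam k (I : mindex m k) (p : M) : 'I_k -> M :=
  fun a => df (lfct (xfam x I a)) p.

Definition hat_ext k (u : ext R m k) : form R m k :=
  fun p v => \sum_(I : mindex m k) u I * dwedge (dl_fam I p) v.

Definition bar k (w : text g m k) : form R m k :=
  text_lift x (fun v u => (fun p xi => lfct v p * hat_ext u p xi) : form R m k) w.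

Definition Phi N (e : omni g m N) : courant R m N := (hat_end e.1, hat_ext e.2).

Definition linear_vfield (X : vfield R m) : Prop := linear X.

Definition constant_form k (al : form R m k) : Prop :=
  exists2 c, alt_multilinear c & al = fun=> c.
End Linearization.

(* The coordinate definitions above agree with the intrinsic ones: the maps
   induced by alternating multilinear maps have the expected values on
   decomposable elements, and these span.  See [ext_lift_wedge], [ext_expand],
   [ad_wedge], [Lext_wedge], [contraction_wedge], [lin_pi_dl], [hat_ext_wedge]
   and [bar_tens]. *)

Section MultilinearTheory.
Variables (K : comNzRingType) (V W : lmodType K).

Lemma fcons_eta k (v : 'I_k.+1 -> V) :
  fcons (v ord0) (fun i => v (lift ord0 i)) = v.
Proof. by apply/funext => i; rewrite /fcons; case: unliftP => [j|] ->. Qed.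

Lemma upd_fcons0 k (v : 'I_k -> V) w w' :
  upd (fcons w v) ord0 w' = fcons w' v.
Proof.
by apply/funext => i; rewrite /upd /fcons; case: unliftP => [j|] ->.
Qed.

Lemma upd_fconsS k (v : 'I_k -> V) w i w' :
  upd (fcons w v) (lift ord0 i) w' = fcons w (upd v i w').
Proof.
apply/funext => j; rewrite /upd /fcons; case: unliftP => [j'|] -> //=.
Qed.

Lemma upd_perm k (v : 'I_k -> V) (s : 'S_k) i w :
  upd (fun j => v (s j)) i w = fun j => upd v (s i) w (s j).
Proof. by apply/funext => j; rewrite /upd (inj_eq perm_inj). Qed.

Lemma upd_id k (v : 'I_k -> V) i : upd v i (v i) = v.
Proof. by apply/funext => j; rewrite /upd; case: eqP => [->|]. Qed.

Lemma upd_upd k (v : 'I_k -> V) i w w' : upd (upd v i w) i w' = upd v i w'.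
Proof. by apply/funext => j; rewrite /upd; case: eqP. Qed.

Lemma updC k (v : 'I_k -> V) i j w w' : i != j ->
  upd (upd v i w) j w' = upd (upd v j w') i w.
Proof.
move=> ij; apply/funext => l; rewrite /upd; case: eqP => [->|] //.
by rewrite eq_sym (negbTE ij).
Qed.

Lemma multilinear_fcons k (f : ('I_k.+1 -> V) -> W) w :
  multilinear f -> multilinear (fun v => f (fcons w v)).
Proof. by move=> mf v i a w1 w2; rewrite -!upd_fconsS mf. Qed.

Lemma multilinear_fcons_linear k (f : ('I_k.+1 -> V) -> W) v :
  multilinear f -> linear (fun w => f (fcons w v)).
Proof.
move=> mf a w1 w2.
by have := mf (fcons 0 v) ord0 a w1 w2; rewrite !upd_fcons0.
Qed.

Lemma linear_sum_of (f : V -> W) (I : finType) (c : I -> K) (y : I -> V) :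
  linear f -> f (\sum_i c i *: y i) = \sum_i c i *: f (y i).
Proof.
move=> lf; pose fL := GRing.isLinear.Build K V W *:%R f lf.
pose F : {linear V -> W} := HB.pack f fL.
rewrite -[f]/(F : _ -> _) linear_sum; apply: eq_bigr => i _.
exact: linearZ.
Qed.

Lemma multilinear_expand k (f : ('I_k -> V) -> W) m (x : 'I_m -> V)
    (c : 'I_m -> 'I_k -> K) :
  multilinear f ->
  f (fun a => \sum_i c i a *: x i) =
  \sum_(j : {ffun 'I_k -> 'I_m}) (\prod_a c (j a) a) *: f (fun a => x (j a)).
Proof.
elim: k f c => [|k IH] f c mf.
  rewrite (big_pred1 [ffun i : 'I_0 => widen_ord (leq0n m) i]); last first.
    by move=> j; rewrite /=; apply/esym/eqP/ffunP => -[].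
  by rewrite big_ord0 scale1r; congr f; apply/funext => -[].
rewrite -[X in f X]fcons_eta /=.
rewrite (linear_sum_of _ _ (multilinear_fcons_linear _ mf)).
transitivity (\sum_i \sum_(j : {ffun 'I_k -> 'I_m})
    (c i ord0 * \prod_a c (j a) (lift ord0 a)) *: f (fcons (x i) (fun a => x (j a)))).
  apply: eq_bigr => i _.
  rewrite (IH _ (fun l a => c l (lift ord0 a)) (multilinear_fcons (x i) mf)).
  by rewrite scaler_sumr; apply: eq_bigr => j _; rewrite scalerA.
rewrite pair_big /=.
pose h (j : {ffun 'I_k.+1 -> 'I_m}) : 'I_m * {ffun 'I_k -> 'I_m} :=
  (j ord0, [ffun a => j (lift ord0 a)]).
pose h' (t : 'I_m * {ffun 'I_k -> 'I_m}) : {ffun 'I_k.+1 -> 'I_m} :=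
  [ffun a => fcons t.1 t.2 a].
have hK : cancel h h'.
  move=> j; apply/ffunP => a; rewrite ffunE /h /= /fcons.
  by case: unliftP => [b|] -> //=; rewrite ffunE.
have h'K : cancel h' h.
  move=> [i t]; rewrite /h /h' ffunE /fcons unlift_none /=; congr pair.
  by apply/ffunP => b; rewrite !ffunE liftK.
rewrite [LHS](reindex h); last by exists h' => ? _; rewrite ?hK ?h'K.
apply: eq_bigr => j _ /=.
rewrite big_ord_recl; congr (_ *: f _).
  by congr (_ * _); apply: eq_bigr => a _; rewrite ffunE.
by apply/funext => i; rewrite /fcons; case: unliftP => [b|] -> //=; rewrite ffunE.
Qed.
End MultilinearTheory.

Section Sorting.
Variables (m k : nat).

Lemma mindex_inj (I : mindex m k) : injective (val I).
Proof.
case: I => I /= /forallP hI a b eab.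
apply/eqP; rewrite -val_eqE /=; case: ltngtP => //= h; exfalso.
  by have /forallP/(_ b)/implyP/(_ h) := hI a; rewrite eab ltnn.
by have /forallP/(_ a)/implyP/(_ h) := hI b; rewrite eab ltnn.
Qed.

Definition mindex_perm (t : mindex m k * 'S_k) : {ffun 'I_k -> 'I_m} :=
  [ffun a => val t.1 (t.2 a)].

Lemma sorted_mindex (I : mindex m k) :
  sorted ltn [seq val (val I a) | a <- enum 'I_k].
Proof.
rewrite sorted_map; apply: (@sub_sorted _ (relpre val ltn)); last first.
  by rewrite -sorted_map val_enum_ord iota_ltn_sorted.
by move=> a b /= ab; have /forallP/(_ a)/forallP/(_ b)/implyP := valP I; apply.
Qed.

Lemma mindex_perm_inj : injective mindex_perm.
Proof.
move=> [I s] [J t] /ffunP e.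
have eIJ : I = J.
  have eq_mem : perm_eq [seq val (val I a) | a <- enum 'I_k]
                        [seq val (val J a) | a <- enum 'I_k].
    apply: uniq_perm.
    - by rewrite map_inj_uniq ?enum_uniq// => a b /val_inj /mindex_inj.
    - by rewrite map_inj_uniq ?enum_uniq// => a b /val_inj /mindex_inj.
    move=> y; apply/mapP/mapP => -[a _ ->].
      exists (t (s^-1%g a)); rewrite ?mem_enum//.
      by have := e (s^-1%g a); rewrite !ffunE /= permKV => ->.
    exists (s (t^-1%g a)); rewrite ?mem_enum//.
    by have := e (t^-1%g a); rewrite !ffunE /= permKV => ->.
  have := irr_sorted_eq ltn_trans ltnn (sorted_mindex I) (sorted_mindex J)
     (perm_mem eq_mem).
  move=> /eq_in_map eqI; apply/val_inj/ffunP => a; apply/val_inj.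
  by apply: eqI; rewrite mem_enum.
subst J; congr pair; apply/permP => a; apply: (@mindex_inj I).
by have := e a; rewrite !ffunE.
Qed.

Lemma mindex_perm_codom (j : {ffun 'I_k -> 'I_m}) :
  injective j -> exists t, mindex_perm t = j.
Proof.
move=> ij; pose r := [rel a b : 'I_m | (a <= b)%N].
pose S := sort r (codom j).
have sS : size S = k by rewrite size_sort size_codom card_ord.
have uS : uniq S by rewrite sort_uniq; apply/injectiveP.
have srt : sorted r S by apply: sort_sorted => a b; exact: leq_total.
pose I : {ffun 'I_k -> 'I_m} := [ffun a => tnth (Tuple (introT eqP sS)) a].
have incI : increasing I.
  apply/forallP => a; apply/forallP => b; apply/implyP => ab.
  rewrite ltn_neqAle; apply/andP; split; last first.
    rewrite !ffunE !(tnth_nth (I a)).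
    apply: (sorted_leq_nth (leT := r)) => //=.
    - by move=> ? ? ?; apply: leq_trans.
    - by rewrite inE sS.
    - by rewrite inE sS.
    - exact: ltnW.
  rewrite val_eqE !ffunE !(tnth_nth (I a)) /= nth_uniq ?sS //.
  by rewrite neq_ltn ab.
have memI a : exists b, I b == j a.
  have : j a \in S by rewrite mem_sort codom_f.
  move=> /[dup] hS; rewrite -index_mem sS => lt.
  exists (Ordinal lt); apply/eqP.
  by rewrite ffunE (tnth_nth (j a)) /= nth_index.
pose s a := xchoose (memI a).
have sE a : I (s a) = j a by apply/eqP/(xchooseP (memI a)).
have is_ : injective s by move=> a b eab; apply: ij; rewrite -!sE eab.
exists (Sub I incI, perm is_).
by apply/ffunP => a; rewrite ffunE /= permE sE.
Qed.
End Sorting.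

Section WedgeTheory.
Variables (K : numFieldType) (V W : lmodType K).

Lemma skew_eq0 k (f : ('I_k -> V) -> W) v i j :
  skew_symmetric f -> i != j -> v i = v j -> f v = 0.
Proof.
move=> sf ij e; have := sf (tperm i j) v.
rewrite odd_tperm ij expr1 scaleN1r.
have -> : (fun l => v (tperm i j l)) = v.
  by apply/funext => l; case: tpermP => // ->.
move/eqP; rewrite -subr_eq0 opprK -mulr2n -scaler_nat scaler_eq0.
by rewrite pnatr_eq0 /= => /eqP.
Qed.

Lemma alt_expand k (f : ('I_k -> V) -> W) m (x : 'I_m -> V)
    (c : 'I_m -> 'I_k -> K) :
  alt_multilinear f ->
  f (fun a => \sum_i c i a *: x i) =
  \sum_(I : mindex m k)
    (\det (\matrix_(a, b) c (val I a) b)) *: f (fun a => x (val I a)).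
Proof.
move=> [mf sf]; rewrite multilinear_expand //.
rewrite (bigID (fun j : {ffun 'I_k -> 'I_m} => injectiveb j)) /=.
rewrite addrC big1 ?add0r => [|j]; last first.
  move=> /injectivePn [a [b ab e]].
  by rewrite (skew_eq0 sf ab) ?scaler0 // e.
transitivity (\sum_(j in [set mindex_perm t | t in [set: mindex m k * 'S_k]])
    (\prod_a c (j a) a) *: f (fun a => x (j a))).
  apply: eq_bigl => j; apply/injectiveP/imsetP => [/mindex_perm_codom[t <-]|].
    by exists t.
  move=> [[I s] _ ->] a b; rewrite !ffunE /= => /mindex_inj; exact: perm_inj.
rewrite big_imset /=; last by move=> ? ? _ _; exact: mindex_perm_inj.
transitivity (\sum_(t : mindex m k * 'S_k)
  (\prod_a c (mindex_perm t a) a) *: f (fun a => x (mindex_perm t a))).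
  by apply: eq_bigl => t; rewrite inE.
rewrite -(pair_bigA _ (fun I s => (\prod_a c (mindex_perm (I, s) a) a) *:
   f (fun a => x (mindex_perm (I, s) a)))) /=.
apply: eq_bigr => I _.
rewrite -det_tr /determinant scaler_suml; apply: eq_bigr => s _.
have -> : (fun a => x (mindex_perm (I, s) a)) = (fun a => x (val I (s a))).
  by apply/funext => a; rewrite ffunE.
rewrite (sf s (fun a => x (val I a))) scalerA mulrC; congr (_ * _ *: _).
by apply: eq_bigr => a _; rewrite ffunE !mxE.
Qed.
End WedgeTheory.

Lemma det_linear_alt (K : numFieldType) (V : lmodType K) k
    (phi : 'I_k -> V -> K^o) : (forall a, linear (phi a)) ->
  alt_multilinear (fun v : 'I_k -> V => (\det (\matrix_(a, b) phi a (v b)) : K^o)).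
Proof.
move=> lphi; split=> [v i a w w'|s v].
  rewrite -[in LHS]det_tr.
  rewrite (@determinant_multilinear _ _ _
    (\matrix_(c, b) phi c (upd v i w b))^T
    (\matrix_(c, b) phi c (upd v i w' b))^T i a 1).
  - by rewrite !det_tr mul1r.
  - by apply/rowP => b; rewrite !mxE /upd eqxx lphi mul1r.
  - by apply/matrixP => b c; rewrite !mxE /upd eq_sym (negbTE (neq_lift _ _)).
  - by apply/matrixP => b c; rewrite !mxE /upd eq_sym (negbTE (neq_lift _ _)).
transitivity (\det (col_perm s (\matrix_(a, b) phi a (v b)))).
  by congr (\det _); apply/matrixP => a b; rewrite !mxE.
by rewrite col_permE det_mulmx det_perm odd_permV mulrC.
Qed.

Section ExteriorTheory.
Variables (K : numFieldType) (g : vectType K) (m : nat) (x : m.-tuple g).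
Hypothesis hx : basis_of fullv x.

Lemma coord_tnth (i j : 'I_m) : coord x i (tnth x j) = (i == j)%:R.
Proof.
by rewrite (tnth_nth 0) coord_free ?(basis_free hx) // eq_sym.
Qed.

Lemma coord_expand v : v = \sum_(i < m) coord x i v *: tnth x i.
Proof.
rewrite {1}(coord_basis hx (memvf v)).
by apply: eq_bigr => i _; rewrite (tnth_nth 0).
Qed.

Lemma ext_lift_wedge k (W : lmodType K) (f : ('I_k -> g) -> W) v :
  alt_multilinear f -> ext_lift x f (wedge x v) = f v.
Proof.
move=> af.
have {1}-> : f v = f (fun a => \sum_i coord x i (v a) *: tnth x i).
  by congr f; apply/funext => a; exact: coord_expand.
rewrite (alt_expand _ (fun i a => coord x i (v a)) af); apply: eq_bigr => I _.
by rewrite ffunE.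
Qed.

Lemma wedge_alt k : alt_multilinear (wedge (k := k) x).
Proof.
have altI (I : mindex m k) := @det_linear_alt _ _ k
  (fun a v => coord x (val I a) v) (fun a => linearP _).
by split=> [v i a w w'|s v]; apply/ffunP => I; rewrite !ffunE; case: (altI I).
Qed.
End ExteriorTheory.

Lemma upd_fsnoc (V : Type) k (v : 'I_k -> V) w i w' :
  upd (fsnoc v w) (lift ord_max i) w' = fsnoc (upd v i w') w.
Proof.
apply/funext => j; rewrite /upd /fsnoc; case: unliftP => [j'|] -> /=.
  by rewrite (inj_eq (@lift_inj _ ord_max)).
by rewrite (negbTE (neq_lift _ _)).
Qed.

Lemma upd_fsnoc_max (V : Type) k (v : 'I_k -> V) w w' :
  upd (fsnoc v w) ord_max w' = fsnoc v w'.
Proof.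
apply/funext => j; rewrite /upd /fsnoc; case: unliftP => [j'|] -> /=.
  by rewrite eq_sym (negbTE (neq_lift _ _)).
by rewrite eqxx.
Qed.

Lemma lift_permP k (s : 'S_k.+1) i : exists s', s = lift_perm i (s i) s'.
Proof.
pose t (j : 'I_k) := odflt j (unlift (s i) (s (lift i j))).
have tE j : lift (s i) (t j) = s (lift i j).
  rewrite /t; have := neq_lift i j.
  by rewrite -(inj_eq (@perm_inj _ s)) => /unlift_some[] ? ? ->.
have ti : injective t.
  move=> a b eab; apply: (@lift_inj _ i); apply: (@perm_inj _ s).
  by rewrite -!tE eab.
exists (perm ti); apply/permP => j.
case: (unliftP i j) => [j'|] ->; rewrite ?lift_perm_id //.
by rewrite lift_perm_lift permE tE.
Qed.

Section InducedMaps.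
Variables (K : numFieldType) (g : vectType K) (m : nat) (x : m.-tuple g).
Hypothesis hx : basis_of fullv x.

Lemma alt_fsnoc (W : lmodType K) k (f : ('I_k.+1 -> g) -> W) w :
  alt_multilinear f -> alt_multilinear (fun v => f (fsnoc v w)).
Proof.
move=> [mf sf]; split=> [v i a w1 w2|s v]; first by rewrite -!upd_fsnoc mf.
have := sf (lift_perm ord_max ord_max s) (fsnoc v w).
rewrite odd_lift_perm addbb addFb => <-; congr f; apply/funext => i.
rewrite /fsnoc; case: unliftP => [j|] -> /=.
  by rewrite lift_perm_lift liftK.
by rewrite lift_perm_id unlift_none.
Qed.

Lemma ext_lift_is_linear k (W : lmodType K) (f : ('I_k -> g) -> W) :
  linear (ext_lift x f).
Proof.
move=> a u v; rewrite /ext_lift scaler_sumr -big_split /=; apply: eq_bigr => I _.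
by rewrite !ffunE scalerDl scalerA.
Qed.

Lemma adE N (br : ('I_N.+2 -> g) -> g) u w : multilinear br ->
  ad x br u w = ext_lift x (fun v => br (fsnoc v w)) u.
Proof.
move=> mb; pose f w := ext_lift x (fun v => br (fsnoc v w)) u.
have lf : linear f.
  move=> a w1 w2; rewrite /f /ext_lift scaler_sumr -big_split /=.
  apply: eq_bigr => I _; rewrite scalerA mulrC -scalerA -scalerDr.
  congr (_ *: _); rewrite -(upd_fsnoc_max _ 0) mb !upd_fsnoc_max //.
pose F : {linear g -> g} := HB.pack f (GRing.isLinear.Build K g g *:%R f lf).
exact: (lfunE F).
Qed.

Lemma ad_wedge N (br : ('I_N.+2 -> g) -> g) v w : alt_multilinear br ->
  ad x br (wedge x v) w = br (fsnoc v w).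
Proof.
move=> ab; rewrite adE; last by case: ab.
exact: (ext_lift_wedge hx v (alt_fsnoc w ab)).
Qed.

Lemma Lext_alt k (A : 'End(g)) : alt_multilinear
  (fun v : 'I_k -> g => \sum_(i < k) wedge x (upd v i (A (v i)))).
Proof.
have [mw sw] := wedge_alt x k.
split=> [v j a w1 w2|s v].
  rewrite scaler_sumr -big_split /=; apply: eq_bigr => i _.
  have [->|ij] := eqVneq i j.
    by rewrite !upd_upd /upd eqxx linearP; exact: mw.
  have E w : upd (upd v j w) i (A (upd v j w i)) = upd (upd v i (A (v i))) j w.
    by rewrite updC 1?eq_sym // /upd (negbTE ij).
  by rewrite !E mw.
rewrite scaler_sumr [in RHS](reindex_inj (@perm_inj _ s)) /=.
by apply: eq_bigr => i _; rewrite upd_perm sw.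
Qed.

Lemma Lext_wedge k (A : 'End(g)) (v : 'I_k -> g) :
  Lext x A (wedge x v) = \sum_(i < k) wedge x (upd v i (A (v i))).
Proof. exact: (ext_lift_wedge hx v (Lext_alt k A)). Qed.

Lemma ext_expand k (u : ext K m k) :
  u = \sum_(I : mindex m k) u I *: wedge x (xfam x I).
Proof.
apply/ffunP => J; rewrite sum_ffunE (bigD1 J) //= big1 ?addr0 => [|I IJ].
  rewrite !ffunE (_ : \matrix_(a, b) _ = 1%:M) ?det1 ?[_ *: _]mulr1 //.
  apply/matrixP => a b; rewrite !mxE coord_tnth //.
  by rewrite (inj_eq (@mindex_inj _ _ J)).
rewrite !ffunE; apply/eqP; rewrite scaler_eq0; apply/orP; right.
have [b nb|all] := pickP (fun a => ~~ [exists b, val J a == val I b]).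
  rewrite (expand_det_row _ b) big1 // => c _; rewrite mxE coord_tnth //.
  move: nb; rewrite negb_exists => /forallP/(_ c)/negbTE ->.
  by rewrite mul0r.
exfalso; move/eqP: IJ; apply.
have allP a : exists b, val J a == val I b.
  by apply/existsP; have := all a => /negbFE.
pose s a := xchoose (allP a).
have sE a : val I (s a) = val J a by apply/esym/eqP/(xchooseP (allP a)).
have si : injective s.
  by move=> a b eab; apply: (@mindex_inj _ _ J); rewrite -!sE eab.
have : mindex_perm (I, perm si) = mindex_perm (J, 1%g).
  by apply/ffunP => a; rewrite !ffunE /= permE perm1 sE.
by move=> /mindex_perm_inj [].
Qed.

Lemma tensPl k (a : K) (w w' : g) (u : ext K m k) :
  tens (a *: w + w') u = a *: tens w u + tens w' u.
Proof.
by apply/ffunP => I; rewrite !ffunE scalerDr !scalerA mulrC.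
Qed.

Lemma tensPr k (a : K) (w : g) (u u' : ext K m k) :
  tens w (a *: u + u') = a *: tens w u + tens w u'.
Proof. by apply/ffunP => I; rewrite !ffunE scalerDl scalerA. Qed.

Lemma tensZr k (a : K) (w : g) (u : ext K m k) : tens w (a *: u) = a *: tens w u.
Proof. by apply/ffunP => I; rewrite !ffunE scalerA. Qed.

Lemma contraction_alt N (A : 'End(g)) : alt_multilinear (fun v : 'I_N.+1 -> g =>
  \sum_(i < N.+1) (-1) ^+ i *: tens (A (v i)) (wedge x (omit v i))).
Proof.
have [mw sw] := wedge_alt x N.
split=> [v j a w1 w2|s v].
  rewrite scaler_sumr -big_split /=; apply: eq_bigr => i _.
  rewrite scalerA mulrC -scalerA -scalerDr; congr (_ *: _).
  case: (unliftP i j) => [j'|] ->.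
    have E w : omit (upd v (lift i j') w) i = upd (omit v i) j' w.
      by apply/funext => l; rewrite /omit /upd (inj_eq (@lift_inj _ i)).
    have U w : upd v (lift i j') w i = v i by rewrite /upd (negbTE (neq_lift _ _)).
    by rewrite !E !U mw tensPr.
  have E w : omit (upd v i w) i = omit v i.
    by apply/funext => l; rewrite /omit /upd eq_sym (negbTE (neq_lift _ _)).
  have U w : upd v i w i = w by rewrite /upd eqxx.
  by rewrite !E !U linearP tensPl.
rewrite scaler_sumr [in RHS](reindex_inj (@perm_inj _ s)) /=.
apply: eq_bigr => i _.
have [s' es] := lift_permP s i.
have -> : omit (fun a => v (s a)) i = (fun a => omit v (s i) (s' a)).
  by apply/funext => l; rewrite /omit {1}es lift_perm_lift.
have -> : s = odd i (+) odd (s i) (+) s' :> bool by rewrite {1}es odd_lift_perm.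
rewrite sw tensZr !scalerA; congr (_ *: _).
rewrite -(signr_odd _ i) -(signr_odd _ (s i)).
by case: (odd i) (odd (s i)) (odd_perm s') => [] [] [] /=;
  rewrite ?expr0 ?expr1 ?mulrN1 ?mulr1 ?opprK.
Qed.

Lemma contraction_wedge N (A : 'End(g)) (v : 'I_N.+1 -> g) :
  contraction x A (wedge x v) =
  \sum_(i < N.+1) (-1) ^+ i *: tens (A (v i)) (wedge x (omit v i)).
Proof. exact: (ext_lift_wedge hx v (contraction_alt N A)). Qed.
End InducedMaps.

Section LinearizationTheory.
Variables (R : realType) (g : vectType R) (m : nat) (x : m.-tuple g).
Hypothesis hx : basis_of fullv x.
Notation M := 'rV[R]_m.

Lemma lfct_linear p : linear (fun v => lfct x v p : R^o).
Proof.
move=> a v w; rewrite /lfct scaler_sumr -big_split /=; apply: eq_bigr => i _.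
by rewrite linearP mulrDl -scalerAl.
Qed.

Lemma lfct_basis i p : lfct x (tnth x i) p = p 0 i.
Proof.
rewrite /lfct (bigD1 i) //= coord_tnth // eqxx mul1r big1 ?addr0 // => j ji.
by rewrite coord_tnth // (negbTE ji) mul0r.
Qed.

Lemma derive_lfct v p w : 'D_w (lfct x v) p = lfct x v w.
Proof.
rewrite /derive; apply: lim_near_cst => //.
near=> h.
have h0 : h != 0 by near: h; exact: nbhs_dnbhs_neq.
rewrite /= /lfct -sumrB -[_ *: _]/(_ * _) mulr_sumr; apply: eq_bigr => i _.
by rewrite !mxE -mulrBr addrK mulrCA mulKf.
Unshelve. all: by end_near. Qed.

Lemma df_lfct v p : df (lfct x v) p = \row_i coord x i v.
Proof.
apply/rowP => i; rewrite !mxE derive_lfct /lfct (bigD1 i) //= big1 => [|j ji].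
  by rewrite mxE !eqxx mulr1 addr0.
by rewrite mxE eqxx (negbTE ji) mulr0.
Qed.

Lemma dotp_frame i (v : M) : dotp (frame R i) v = v 0 i.
Proof.
rewrite /dotp (bigD1 i) //= big1 => [|j ji]; first by rewrite mxE !eqxx mul1r addr0.
by rewrite mxE eqxx (negbTE ji) mul0r.
Qed.

Lemma lin_pi_dl N (br : ('I_N.+2 -> g) -> g) (y : 'I_N.+2 -> g) p :
  alt_multilinear br ->
  lin_pi x br p (fun i => df (lfct x (y i)) p) = lfct x (br y) p.
Proof.
move=> [mb sb].
have af : alt_multilinear (fun y => lfct x (br y) p : R^o).
  split=> [v i a w w'|s v]; first by rewrite mb lfct_linear.
  rewrite sb; have := lfct_linear p ((-1) ^+ s) (br v) 0.
  have -> : lfct x 0 p = 0 by apply: big1 => i _; rewrite linear0 mul0r.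
  by rewrite !addr0.
rewrite -(ext_lift_wedge hx y af); apply: eq_bigr => I _.
rewrite ffunE mulrC; congr (\det _ * _); apply/matrixP => a b.
by rewrite !mxE dotp_frame df_lfct mxE.
Qed.

Lemma hat_ext_wedge k (y : 'I_k -> g) p v :
  hat_ext x (wedge x y) p v = dwedge (fun a => df (lfct x (y a)) p) v.
Proof.
pose phi (b : 'I_k) (w : g) : R^o := dotp (df (lfct x w) p) (v b).
have lphi b : linear (phi b).
  move=> a w w'; rewrite /phi !df_lfct /dotp scaler_sumr -big_split /=.
  by apply: eq_bigr => i _; rewrite !mxE linearP mulrDl -scalerAl.
have := ext_lift_wedge hx y (det_linear_alt lphi) => E.
rewrite /dwedge -[RHS]det_tr; move: E.
have -> : (\matrix_(a, b) dotp (df (lfct x (y a)) p) (v b))^T =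
  \matrix_(a, b) phi a (y b) by apply/matrixP => a b; rewrite !mxE.
move=> <-; apply: eq_bigr => I _; rewrite -[in RHS]det_tr.
by congr (_ * \det _); apply/matrixP => a b; rewrite !mxE.
Qed.

Lemma bar_tens k (w : g) (u : ext R m k) p v :
  bar x (tens w u) p v = lfct x w p * hat_ext x u p v.
Proof.
rewrite /bar /text_lift.
have sumE (I : finType) (F : I -> form R m k) : (\sum_i F i) p v = \sum_i F i p v.
  by elim/big_rec2: _ => //= i y1 y2 _ <-.
rewrite sumE mulr_sumr; apply: eq_bigr => I _.
rewrite ffunE hat_ext_wedge mulrA [_ * u I]mulrC; congr (_ * _).
have := lfct_linear p (u I) w 0.
have -> : lfct x 0 p = 0 by apply: big1 => i _; rewrite linear0 mul0r.
by rewrite !addr0.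
Qed.
End LinearizationTheory.

(* Main.v *)
Require Import Defs.
From HB Require Import structures.
From mathcomp Require Import all_boot all_order all_algebra all_fingroup.
From mathcomp Require Import all_classical all_reals all_analysis.

Set Implicit Arguments.
Unset Strict Implicit.
Unset Printing Implicit Defensive.

Import Order.TTheory GRing.Theory Num.Theory numFieldNormedType.Exports.
Local Open Scope ring_scope.

(** The theorem says that linear fields and constant forms on g^* form a copy
    of gl(g) + /\^(n-1) g inside the Courant-type bundle.  All the geometric
    operations can be computed there because differentiation degenerates on
    such tensors: the derivative of a linear map is the map itself
    ([derive_linear_fun]) and that of a constant is zero.  The Lie derivative
    of a constant form c along a linear field X is then purely algebraic:
    it is the sum of the c(v_1, ..., X v_i, ..., v_k) ([Lie_form_cst]).

    The link with g is a duality.  A point p of g^* pairs with v in g by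
    l_v(p), and the linear field A^ is the transpose of A for this pairing:
    l_v(A^ p) = l_(A v)(p) ([lfct_hat_end]).  The constant form attached to
    y_1 /\ ... /\ y_k has the value det(l_(y_a)(v_b)) on v_1, ..., v_k
    ([hat_ext_wedgeE]), so identities between forms become identities between
    determinants, extended linearly from decomposable elements:
    - L_(A^) u^ = (L_A u)^ ([Lie_hat_ext]), because replacing the columns of a
      determinant one at a time gives the same total as replacing its rows
      ([det_upd_rows_cols]);
    - i_(A^) u^ is the bar of the contraction of u by A ([interior_hat_ext]),
      by expansion along the first column, which is the pairing identity;
    - L_(A^) bar w = bar (L_A w) ([Lie_bar]), from the first identity and the
      Leibniz rule for the linear coefficients l_v.

    On fields, [A^, B^] is the hat of the commutator ([lie_hat_end]), and the
    formula pi(dl_(y_1), ..., dl_(y_n)) = l_[y_1, ..., y_n] says that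
    pi^sharp(u^) is the hat of ad_u ([sharp_hat_ext]).  In the bracket all
    terms with d u^ vanish, as u^ is constant, and what is left to understand
    is [u^, v^]_pi: by Cartan's formula for constant forms ([cartan_cst]) the
    exact term d i u^ cancels the Lie derivative of u^, which leaves the Lie
    derivative of v^ along the hat of ad_u, that is, the hat of u o v. *)

(** * Linear and skew-symmetric maps *)

Section AlternatingMaps.
Variables (K : comNzRingType) (V W : lmodType K).

Lemma linear_of_sum (f : V -> W) (I : finType) (y : I -> V) :
  linear f -> f (\sum_i y i) = \sum_i f (y i).
Proof.
move=> lf; rewrite (eq_bigr (fun i => 1 *: y i)) => [|i _]; last first.
  by rewrite scale1r.
by rewrite linear_sum_of //; apply: eq_bigr => i _; rewrite scale1r.
Qed.

Lemma multilinear_upd_linear k (f : ('I_k -> V) -> W) v i :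
  multilinear f -> linear (fun w => f (upd v i w)).
Proof. by move=> mf a w w'; rewrite mf. Qed.

Lemma linear_of0 (f : V -> W) : linear f -> f 0 = 0.
Proof.
move=> lf; have /eqP := lf 1 0 0.
by rewrite !scale1r addr0 -[X in X == _]addr0 (inj_eq (addrI _)) eq_sym => /eqP.
Qed.

Lemma linear_of_opp (f : V -> W) w : linear f -> f (- w) = - f w.
Proof.
by move=> lf; rewrite -[- w]addr0 -scaleN1r lf linear_of0 // addr0 scaleN1r.
Qed.

Lemma linear_of_sub (f : V -> W) v w : linear f -> f (v - w) = f v - f w.
Proof. by move=> lf; rewrite addrC -scaleN1r lf scaleN1r addrC. Qed.

Lemma linear_of_add (f : V -> W) : linear f -> {morph f : v w / v + w}.
Proof. by move=> lf v w; have := lf 1 v w; rewrite !scale1r. Qed.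

(** The two families of arguments differ by the cycle that carries position i
    to the front, a permutation of sign (-1)^i. *)
Lemma skew_fcons_omit k (f : ('I_k.+1 -> V) -> W) v i w : skew_symmetric f ->
  f (fcons w (omit v i)) = (-1) ^+ i *: f (upd v i w).
Proof.
move=> sf; have := sf (lift_perm i ord0 1%g) (fcons w (omit v i)).
rewrite odd_lift_perm odd_perm1 /= !addbF signr_odd.
have -> : (fun a => fcons w (omit v i) (lift_perm i ord0 1%g a)) = upd v i w.
  apply/funext => a; rewrite /upd; case: (unliftP i a) => [b|] ->.
    by rewrite lift_perm_lift perm1 /fcons liftK eq_sym (negbTE (neq_lift _ _)).
  by rewrite lift_perm_id /fcons unlift_none eqxx.
by move=> ->; rewrite scalerA -expr2 sqrr_sign scale1r.
Qed.
End AlternatingMaps.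

(** Both sides are the derivative of the determinant at P in the direction Q:
    by cofactor expansion they equal the sum of the Q i j * cofactor P i j. *)
Lemma det_upd_rows_cols (K : comNzRingType) k (P Q : 'M[K]_k) :
  \sum_i \det (\matrix_(a, b) (if a == i then Q else P) a b) =
  \sum_i \det (\matrix_(a, b) (if b == i then Q else P) a b).
Proof.
transitivity (\sum_i \sum_j Q i j * cofactor P i j).
  apply: eq_bigr => i _; rewrite (expand_det_row _ i); apply: eq_bigr => j _.
  rewrite !mxE eqxx /cofactor; congr (_ * (_ * \det _)); apply/matrixP => a b.
  by rewrite !mxE eq_sym (negbTE (neq_lift _ _)).
rewrite exchange_big; apply: eq_bigr => j _.
rewrite (expand_det_col _ j); apply: eq_bigr => i _.
rewrite !mxE eqxx /cofactor; congr (_ * (_ * \det _)); apply/matrixP => a b.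
by rewrite !mxE [in RHS]eq_sym (negbTE (neq_lift _ _)).
Qed.

(** * Calculus of linear vector fields and constant forms *)

Lemma derive_linear_fun (R : realType) (V W : normedModType R) (f : V -> W) p w :
  linear f -> 'D_w f p = f w.
Proof.
move=> lf; rewrite /derive; apply: lim_near_cst => //.
near=> h.
have h0 : h != 0 by near: h; exact: nbhs_dnbhs_neq.
by rewrite /= lf addrK scalerK.
Unshelve. all: by end_near. Qed.

(** [derive_cst] for a constant written as an abstraction, the form in which
    the coefficients of constant forms appear. *)
Lemma derive_fun_cst (R : realType) (V W : normedModType R) (c : W) (p w : V) :
  'D_w (fun=> c) p = 0.
Proof. exact: derive_cst. Qed.

Section Fields.
Variables (R : realType) (m : nat).
Notation M := 'rV[R]_m.
Implicit Types X Y : vfield R m.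

Lemma lie_linear X Y p : linear X -> linear Y -> lie X Y p = Y (X p) - X (Y p).
Proof. by move=> lX lY; rewrite /lie !derive_linear_fun. Qed.

Lemma lie_cst X w p : linear X -> lie X (fun=> w) p = - X w.
Proof. by move=> lX; rewrite /lie derive_fun_cst sub0r derive_linear_fun. Qed.

(** The Leibniz rule: the first term differentiates the linear coefficients of
    the form, the second one comes from [X, v] = - X v for constant v. *)
Lemma Lie_form_linear k X (al : Defs.form R m k) p v :
    linear X -> (forall w, linear (fun q => al q w)) -> multilinear (al p) ->
  Lie_form X al p v = al (X p) v + \sum_(i < k) al p (upd v i (X (v i))).
Proof.
move=> lX lal mal; rewrite /Lie_form derive_linear_fun; last exact: lal.
rewrite -sumrN; congr (_ + _); apply: eq_bigr => i _.
rewrite lie_cst // (linear_of_opp _ (multilinear_upd_linear v i mal)).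
exact: opprK.
Qed.

Lemma Lie_form_cst k X c p v : linear X -> multilinear c ->
  Lie_form X ((fun=> c) : Defs.form R m k) p v = \sum_(i < k) c (upd v i (X (v i))).
Proof.
move=> lX mc; rewrite /Lie_form /= derive_fun_cst sub0r -sumrN.
apply: eq_bigr => i _.
rewrite lie_cst // (linear_of_opp _ (multilinear_upd_linear v i mc)).
exact: opprK.
Qed.

Lemma ext_d_cst k c : ext_d ((fun=> c) : Defs.form R m k) = 0.
Proof.
apply/funext => p; apply/funext => v.
by apply: big1 => i _ /=; rewrite derive_fun_cst mulr0.
Qed.

(** Cartan's formula L_X = d i_X + i_X d, whose last term vanishes on a closed
    form.  The invariant formula for d puts X v_i in front, and skew-symmetry
    moves it back to position i, which absorbs the alternating sign. *)
Lemma cartan_cst k X c : linear X -> alt_multilinear c ->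
  ext_d (Defs.interior X ((fun=> c) : Defs.form R m k.+1)) = Lie_form X (fun=> c).
Proof.
move=> lX [mc sc]; apply/funext => p; apply/funext => v.
rewrite Lie_form_cst //; apply: eq_bigr => i _.
rewrite /Defs.interior derive_linear_fun => [|a q q']; last first.
  by rewrite lX multilinear_fcons_linear.
by rewrite skew_fcons_omit // mulrA -expr2 sqrr_sign mul1r.
Qed.

Lemma sharp0 N (pi : mvfield R m N.+2) : sharp pi 0 = 0.
Proof.
apply/funext => p; apply/rowP => j; rewrite !mxE.
by apply: big1 => I _; rewrite mul0r.
Qed.
End Fields.

(** * The linearization on the dual space *)

Section Linearization.
Variables (R : realType) (g : vectType R) (m : nat) (x : m.-tuple g).
Hypothesis hx : basis_of fullv x.
Notation M := 'rV[R]_m.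

Lemma lfct_sum (I : finType) (c : I -> R) (y : I -> g) p :
  lfct x (\sum_i c i *: y i) p = \sum_i c i * lfct x (y i) p.
Proof. exact: (linear_sum_of c y (lfct_linear x p)). Qed.

Lemma dl_fam_frame k (I : mindex m k) p : dl_fam x I p = frame_fam R I.
Proof.
apply/funext => a; rewrite /dl_fam df_lfct; apply/rowP => i.
by rewrite !mxE coord_tnth // eqxx.
Qed.

Lemma hat_extE k (u : ext R m k) p :
  hat_ext x u p = fun v => \sum_I u I * dwedge (frame_fam R I) v.
Proof. by apply/funext => v; apply: eq_bigr => I _; rewrite dl_fam_frame. Qed.

(** Exhibits a hatted form literally as a constant family, so that the calculus
    of constant forms applies; the value at 0 is only a representative. *)
Lemma hat_ext_cst k (u : ext R m k) : hat_ext x u = fun=> hat_ext x u 0.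
Proof. by apply/funext => p; rewrite !hat_extE. Qed.

Lemma hat_ext_is_linear k p v : linear (fun u : ext R m k => hat_ext x u p v).
Proof.
move=> a u u'; rewrite !hat_extE scaler_sumr -big_split /=.
by apply: eq_bigr => I _; rewrite !ffunE mulrDl -scalerAl.
Qed.

Lemma dwedge_alt k (xi : 'I_k -> M) : alt_multilinear (dwedge xi).
Proof.
apply: (det_linear_alt (phi := fun a v => dotp (xi a) v)) => a c v w.
rewrite /dotp scaler_sumr -big_split /=; apply: eq_bigr => i _.
by rewrite !mxE mulrDr mulrCA.
Qed.

Lemma hat_ext_alt k (u : ext R m k) p : alt_multilinear (hat_ext x u p).
Proof.
rewrite hat_extE; split=> [v i a w w'|s v].
  rewrite scaler_sumr -big_split /=; apply: eq_bigr => I _.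
  by rewrite (proj1 (dwedge_alt _)) mulrDr -scalerAr.
rewrite scaler_sumr /=; apply: eq_bigr => I _.
by rewrite (proj2 (dwedge_alt _)) -scalerAr.
Qed.

(** Evaluation on frames recovers the coordinates of u: this makes the hat
    injective, and computes the coefficients that enter pi^sharp. *)
Lemma hat_ext_frame k (u : ext R m k) p I : hat_ext x u p (frame_fam R I) = u I.
Proof.
rewrite hat_extE [in RHS](ext_expand hx u) sum_ffunE; apply: eq_bigr => J _.
rewrite !ffunE; congr (_ * _); rewrite /dwedge -det_tr; congr (\det _).
by apply/matrixP => a b; rewrite !mxE dotp_frame mxE coord_tnth // eq_sym.
Qed.

(** An alternating form is determined by its values on increasing families of
    frame vectors; hence every constant form is a hat. *)
Lemma alt_form_expand k (c : ('I_k -> M) -> R^o) : alt_multilinear c ->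
  c = hat_ext x [ffun I => c (frame_fam R I)] 0.
Proof.
move=> ac; apply/funext => v; rewrite hat_extE.
have {1}-> : v = fun b => \sum_i v b 0 i *: frame R i.
  by apply/funext => b; exact: row_sum_delta.
rewrite (alt_expand _ (fun i b => v b 0 i) ac); apply: eq_bigr => I _.
rewrite ffunE -[LHS]/(_ * _) mulrC; congr (_ * \det _).
by apply/matrixP => a b; rewrite !mxE dotp_frame.
Qed.

Lemma hat_endE A p : hat_end x A p = \row_i lfct x (A (tnth x i)) p.
Proof. by rewrite [RHS]row_sum_delta; apply: eq_bigr => i _; rewrite mxE. Qed.

Lemma lfct_linear_point v : linear (lfct x v).
Proof.
move=> a p q; rewrite /lfct scaler_sumr -big_split /=; apply: eq_bigr => i _.
by rewrite !mxE mulrDr mulrCA.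
Qed.

Lemma linear_hat_end A : linear (hat_end x A).
Proof.
by move=> a p q; rewrite !hat_endE; apply/rowP => i; rewrite !mxE lfct_linear_point.
Qed.

Lemma lfct_frame i v : lfct x v (frame R i) = coord x i v.
Proof.
rewrite /lfct (bigD1 i) //= mxE !eqxx mulr1 big1 ?addr0 // => j ji.
by rewrite mxE eqxx (negbTE ji) mulr0.
Qed.

Lemma lfct_inj v w : lfct x v =1 lfct x w -> v = w.
Proof.
move=> e; rewrite (coord_expand hx v) (coord_expand hx w).
by apply: eq_bigr => i _; rewrite -!lfct_frame e.
Qed.

(** The field A^ acts on the linear function l_v by l_(A v). *)
Lemma lfct_hat_end A v p : lfct x v (hat_end x A p) = lfct x (A v) p.
Proof.
rewrite [in RHS](coord_expand hx v) linear_sum.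
under eq_bigr do rewrite linearZ.
by rewrite lfct_sum hat_endE; apply: eq_bigr => i _; rewrite mxE.
Qed.

Lemma dotp_df_lfct v p w : dotp (df (lfct x v) p) w = lfct x v w.
Proof. by rewrite df_lfct; apply: eq_bigr => i _; rewrite mxE. Qed.

Lemma hat_ext_wedgeE k (y : 'I_k -> g) p v :
  hat_ext x (wedge x y) p v = \det (\matrix_(a, b) lfct x (y a) (v b)).
Proof.
rewrite hat_ext_wedge //; congr (\det _).
by apply/matrixP => a b; rewrite !mxE dotp_df_lfct.
Qed.

Lemma hat_ext_lift k l (f : ('I_l -> g) -> ext R m k) (u : ext R m l) p v :
  hat_ext x (ext_lift x f u) p v = \sum_I u I * hat_ext x (f (xfam x I)) p v.
Proof. by rewrite (linear_sum_of _ _ (hat_ext_is_linear p v)). Qed.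

(** Reduces an identity that is linear in u to decomposable elements. *)
Lemma hat_ext_wedge_expand k (u : ext R m k) p v :
  hat_ext x u p v = \sum_I u I * hat_ext x (wedge x (xfam x I)) p v.
Proof.
by rewrite {1}(ext_expand hx u) (linear_sum_of _ _ (hat_ext_is_linear p v)).
Qed.

(** On a decomposable u both sides are sums of determinants.  L_A replaces the
    rows l_(y_a) by l_(A y_a) in turn; the right-hand side replaces the columns
    v_b by A^ v_b in turn, and by duality with the same new entries. *)
Lemma hat_Lext k (A : 'End(g)) (u : ext R m k) p v :
  hat_ext x (Lext x A u) p v =
  \sum_(i < k) hat_ext x u p (upd v i (hat_end x A (v i))).
Proof.
rewrite hat_ext_lift.
under [RHS]eq_bigr do rewrite hat_ext_wedge_expand.
rewrite exchange_big; apply: eq_bigr => I _; rewrite -mulr_sumr; congr (_ * _).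
rewrite (linear_of_sum _ (hat_ext_is_linear p v)).
set y := xfam x I; pose P := \matrix_(a, b) lfct x (y a) (v b).
pose Q := \matrix_(a, b) lfct x (A (y a)) (v b).
transitivity (\sum_i \det (\matrix_(a, b) (if a == i then Q else P) a b)).
  apply: eq_bigr => i _; rewrite hat_ext_wedgeE; congr (\det _).
  by apply/matrixP => a b; rewrite !mxE /upd; case: eqP => [->|_]; rewrite mxE.
rewrite det_upd_rows_cols; apply: eq_bigr => i _.
rewrite hat_ext_wedgeE; congr (\det _); apply/matrixP => a b.
by rewrite !mxE /upd; case: eqP => [->|_]; rewrite ?lfct_hat_end mxE.
Qed.

Lemma Lie_hat_ext k A (u : ext R m k) :
  Lie_form (hat_end x A) (hat_ext x u) = hat_ext x (Lext x A u).
Proof.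
apply/funext => p; apply/funext => v; rewrite hat_ext_cst Lie_form_cst.
- by rewrite hat_Lext [in RHS]hat_ext_cst.
- exact: linear_hat_end.
- exact: (proj1 (hat_ext_alt u 0)).
Qed.

Lemma lie_hat_end A B : lie (hat_end x A) (hat_end x B) = hat_end x (comm A B).
Proof.
apply/funext => p; rewrite lie_linear; try exact: linear_hat_end.
apply/rowP => i; rewrite !hat_endE !mxE -!hat_endE !lfct_hat_end.
rewrite /comm add_lfunE opp_lfunE !comp_lfunE.
by rewrite (linear_of_sub _ _ (lfct_linear x p)).
Qed.

Lemma hat_end_is_linear : linear (hat_end x).
Proof.
move=> a A B; apply/funext => p; rewrite !fctE /= !hat_endE; apply/rowP => i.
by rewrite !mxE add_lfunE scale_lfunE lfct_linear.
Qed.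

(** The components of pi^sharp(u^) are contractions of pi_g with differentials
    of coordinates, which [lin_pi_dl] turns into brackets of basis vectors. *)
Lemma sharp_hat_ext N (br : ('I_N.+2 -> g) -> g) (u : ext R m N.+1) :
  alt_multilinear br ->
  sharp (lin_pi x br) (hat_ext x u) = hat_end x (ad x br u).
Proof.
move=> ab; apply/funext => p; rewrite hat_endE; apply/rowP => j; rewrite !mxE.
have [mb _] := ab; rewrite adE // /ext_lift lfct_sum.
apply: eq_bigr => I _; rewrite hat_ext_frame -lin_pi_dl //.
congr (_ * lin_pi _ _ _ _); apply/funext => i.
rewrite /fsnoc; case: unliftP => [a|] _ /=; apply/rowP => l;
  by rewrite df_lfct !mxE coord_tnth // eqxx.
Qed.

Lemma barE k (w : text g m k) p v : bar x w p v =
  \sum_I lfct x (w I) p * hat_ext x (wedge x (xfam x I)) 0 v.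
Proof.
rewrite /bar /text_lift !fct_sumE; apply: eq_bigr => I _.
by rewrite [in LHS]hat_ext_cst.
Qed.

Lemma bar_is_linear k p v : linear (fun w : text g m k => bar x w p v).
Proof.
move=> a w w'; rewrite !barE scaler_sumr -big_split /=.
by apply: eq_bigr => I _; rewrite !ffunE lfct_linear mulrDl -scalerAl.
Qed.

(** Inserting A^ p as first argument makes l_(A y_i)(p) the first column of the
    determinant; expanding along it gives the alternating sum that defines the
    contraction. *)
Lemma interior_hat_ext N A (u : ext R m N.+1) :
  Defs.interior (hat_end x A) (hat_ext x u) = bar x (Defs.contraction x A u).
Proof.
apply/funext => p; apply/funext => v; rewrite /Defs.interior.
rewrite (linear_sum_of _ _ (bar_is_linear p v)) hat_ext_wedge_expand.
apply: eq_bigr => I _; congr (_ * _).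
rewrite hat_ext_wedgeE (expand_det_col _ ord0).
rewrite (linear_sum_of _ _ (bar_is_linear p v)); apply: eq_bigr => i _.
rewrite bar_tens // hat_ext_wedgeE !mxE /fcons unlift_none /= lfct_hat_end.
rewrite /cofactor addn0 mulrCA; congr (_ * (_ * \det _)).
by apply/matrixP => a b; rewrite !mxE liftK.
Qed.

Lemma Lie_bar k A (w : text g m k) :
  Lie_form (hat_end x A) (bar x w) = bar x (Ltext x A w).
Proof.
apply/funext => p; apply/funext => v; rewrite Lie_form_linear.
- rewrite (linear_of_sum _ (bar_is_linear p v)) barE.
  under [X in _ + X]eq_bigr do rewrite barE.
  rewrite exchange_big -big_split /=; apply: eq_bigr => I _.
  rewrite (linear_of_add (bar_is_linear p v)) !bar_tens // lfct_hat_end -mulr_sumr.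
  by rewrite hat_Lext hat_ext_cst.
- exact: linear_hat_end.
- move=> vs a q q'; rewrite !barE scaler_sumr -big_split /=.
  by apply: eq_bigr => I _; rewrite lfct_linear_point mulrDl -scalerAl.
- move=> vs i a y y'; rewrite !barE scaler_sumr -big_split /=.
  apply: eq_bigr => I _; rewrite (proj1 (hat_ext_alt _ _)).
  by rewrite mulrDr -scalerAr.
Qed.

Lemma Phi_linear N : linear (Phi x (N := N)).
Proof.
move=> a [A u] [B v]; congr pair; first exact: hat_end_is_linear.
by apply/funext => p; apply/funext => vs; exact: hat_ext_is_linear.
Qed.

Lemma Phi_inj N : injective (Phi x (N := N)).
Proof.
move=> [A u] [B v] [eAB euv]; congr pair; last first.
  by apply/ffunP => I; rewrite -(hat_ext_frame u 0) euv hat_ext_frame.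
apply/lfunP => y; apply: lfct_inj => p.
by rewrite -!lfct_hat_end eAB.
Qed.

(** Over the basis x, the matrix of A is read off from the values of X on the
    frame: X must be the transpose of A. *)
Lemma linear_vfieldP (X : vfield R m) :
  linear X -> exists A, hat_end x A = X.
Proof.
move=> lX.
pose f y := \sum_j lfct x y (X (frame R j)) *: tnth x j.
have lf : linear f.
  move=> a y z; rewrite /f scaler_sumr -big_split /=; apply: eq_bigr => j _.
  by rewrite lfct_linear scalerDl scalerA.
pose F : {linear g -> g} := HB.pack f (GRing.isLinear.Build R g g *:%R f lf).
exists (linfun F); apply/funext => p; rewrite hat_endE; apply/rowP => i.
rewrite mxE lfunE /= /f lfct_sum.
rewrite [in RHS](row_sum_delta p) (linear_sum_of _ _ lX) summxE.
apply: eq_bigr => j _.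
by rewrite !lfct_basis // !mxE -[LHS]/(_ * _) mulrC.
Qed.

Lemma Phi_image N (s : courant R m N) :
  (exists e : omni g m N, Phi x e = s) <->
  linear_vfield s.1 /\ constant_form s.2.
Proof.
split=> [[[A u] <-] /=|[lX [c ac ec]]].
  split; first exact: linear_hat_end.
  by exists (hat_ext x u 0); [exact: hat_ext_alt | exact: hat_ext_cst].
have [A eA] := linear_vfieldP lX.
exists (A, [ffun I => c (frame_fam R I)]); case: s lX ec eA => X al /= _ -> <-.
by rewrite /Phi /= hat_ext_cst -alt_form_expand.
Qed.
End Linearization.

(** * The omni n-Lie algebra inside the Courant-type bundle *)

Theorem theorem6p4 (R : realType) (N m : nat) (g : vectType R)
    (x : m.-tuple g) (br : ('I_N.+2 -> g) -> g)
    (x_basis : basis_of fullv x)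
    (br_nLie : nLie_bracket br)
    (pi_NP : nambu_poisson (lin_pi x br)) :
  [/\ linear (Phi x (N := N)),
      injective (Phi x (N := N)) &
      forall s : courant R m N,
        (exists e : omni g m N, Phi x e = s) <->
        (linear_vfield s.1 /\ constant_form s.2)]
  /\
  forall (A B : 'End(g)) (u v : ext R m N.+1) (w : text g m N),
    [/\ courant_pairing (Phi x (A, u)) (Phi x (B, v))
          = bar x (omni_pairing x (A, u) (B, v)),
        courant_bracket (lin_pi x br) (Phi x (A, u)) (Phi x (B, v))
          = Phi x (omni_bracket x br (A, u) (B, v)) &
        Lie_form (courant_rho (lin_pi x br) (Phi x (A, u))) (bar x w)
          = bar x (omni_rho x br (A, u) w)].
Proof.
have ab : alt_multilinear br by split; case: br_nLie.
split; first by split; [exact: Phi_linear | exact: Phi_inj | exact: Phi_image].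
move=> A B u v w; split.
- rewrite /= !interior_hat_ext //.
  apply/funext => p; apply/funext => vs.
  by rewrite (linear_of_add (bar_is_linear x_basis p vs)).
- have hatD := linear_of_add (hat_end_is_linear x).
  have hatB := fun C D => linear_of_sub C D (hat_end_is_linear x).
  have du : ext_d (hat_ext x u) = 0 by rewrite hat_ext_cst // ext_d_cst.
  have i0 : Defs.interior (hat_end x B) (0 : Defs.form R m N.+2) = 0 by [].
  have cartan : ext_d (Defs.interior (hat_end x (ad x br v)) (hat_ext x u)) =
      Lie_form (hat_end x (ad x br v)) (hat_ext x u).
    rewrite hat_ext_cst // cartan_cst //; first exact: linear_hat_end.
    exact: hat_ext_alt.
  rewrite /= /form_bracket du i0 !sharp_hat_ext // cartan subrK subr0.
  rewrite !Lie_hat_ext // !sharp_hat_ext // sharp0 addr0 !lie_hat_end //.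
  congr pair; first by rewrite -!hatD -hatB.
  apply/funext => p; apply/funext => vs.
  by rewrite (linear_of_add (hat_ext_is_linear x_basis p vs)).
- rewrite /courant_rho /= sharp_hat_ext // -(linear_of_add (hat_end_is_linear x)).
  exact: Lie_bar.
Qed.
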